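(* Let $\alpha:I\to\mathbb{E}^4_1$ be a null Cartan helix with constant curvatures $\kappa_2=p$, $\kappa_3=q$. Then the tangent vector field $T=\alpha'$ satisfies $$T^{(4)}+p^2T''-q^2T=0 .$$
   Context: Minkowski space-time $\mathbb{E}^4_1$ is $\mathbb{R}^4$ with the metric $\langle x,y\rangle=-x_1y_1+x_2y_2+x_3y_3+x_4y_4$. A null Cartan curve is a smooth null curve $\alpha:I\to\mathbb{E}^4_1$ ($I$ an interval, $\alpha'\neq0$, $\langle\alpha',\alpha'\rangle=0$) parametrized by pseudo-arc length $s$ (so $\langle\alpha'',\alpha''\rangle=1$), together with its Cartan frame $\{T,N,B_1,B_2\}$, $T=\alpha'$, $N=\alpha''$, where $\langle T,T\rangle=\langle B_2,B_2\rangle=0$, $\langle N,N\rangle=\langle B_1,B_1\rangle=1$, $\langle T,B_2\rangle=1$, all other inner products of frame vectors vanish, $\det(T,N,B_1,B_2)=1$, and $$T'=N,\quad N'=\kappa_2B_1-B_2,\quad B_1'=\kappa_3T-\kappa_2N,\quad B_2'=-\kappa_3B_1$$ for smooth functions $\kappa_2,\kappa_3:I\to\mathbb{R}$ (the Cartan curvatures). Primes and $T^{(4)}$ denote derivatives with respect to $s$. A null Cartan helix is a null Cartan curve with $\kappa_2,\kappa_3$ constant and $\kappa_3\neq0$. *)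

(* Defs.v *)
From mathcomp Require Import all_boot all_order all_algebra.
From mathcomp Require Import all_classical all_reals all_analysis.

Set Implicit Arguments.
Unset Strict Implicit.
Unset Printing Implicit Defensive.

Import Order.TTheory GRing.Theory Num.Theory.
Import numFieldNormedType.Exports.

Local Open Scope classical_set_scope.
Local Open Scope ring_scope.

Definition nondegenerate_interval (R : realType) (I : set R) : Prop :=
  is_interval I /\ exists a b : R, [/\ I a, I b & a < b].

Definition diff_quotient (R : realType) (V : normedModType R)
  (f : R -> V) (s h : R) : V := h^-1 *: (f (h + s) - f s).

(* The increments that stay in I; at an end point of I belonging to I, limits
   along this filter are one-sided. *)
Definition increments_in (R : realType) (I : set R) (s : R) : set_system R :=
  within [set h | I (h + s)] 0^'.

Definition derivable_in (R : realType) (V : normedModType R) (I : set R)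
  (f : R -> V) (s : R) : Prop :=
  cvg (diff_quotient f s @ increments_in I s).

(* The values of f outside I play no role in the values at points of I. *)
Definition deriv_in (R : realType) (V : normedModType R) (I : set R)
  (f : R -> V) (s : R) : V :=
  lim (diff_quotient f s @ increments_in I s).

Definition derivn_in (R : realType) (V : normedModType R) (I : set R) (n : nat)
  (f : R -> V) : R -> V := iter n (deriv_in I) f.

Definition smooth_in (R : realType) (V : normedModType R) (I : set R)
  (f : R -> V) : Prop :=
  forall (n : nat) (s : R), I s -> derivable_in I (derivn_in I n f) s.

Lemma increments_in_interior (R : realType) (I : set R) (s : R) :
  I° s -> increments_in I s = 0^'.
Proof.
move=> Is; rewrite /increments_in; apply/seteqP; split => P.
- rewrite /within /= => H.
  have : \forall h \near (0 : R)^', I (h + s).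
    apply: nbhs_dnbhs.
    by move/nbhs0P : Is; apply: filterS => h; rewrite addrC.
  by move=> HI; near=> h; apply: (near H h) => //; near: h.
- by rewrite /within /=; apply: filterS.
Unshelve. all: by end_near. Qed.

Lemma deriv_in_interior (R : realType) (V : normedModType R) (I : set R)
  (f : R -> V) (s : R) : I° s -> deriv_in I f s = derive1 f s.
Proof. by move=> Is; rewrite /deriv_in increments_in_interior. Qed.

(* x_1, ..., x_4 are the entries of x at 0, ..., 3. *)
Definition minkowski (R : realType) (x y : 'rV[R]_4) : R :=
  - (x ord0 (inord 0) * y ord0 (inord 0)) + x ord0 (inord 1) * y ord0 (inord 1)
  + x ord0 (inord 2) * y ord0 (inord 2) + x ord0 (inord 3) * y ord0 (inord 3).

Definition mx_of_rows4 (R : realType) (x y z w : 'rV[R]_4) : 'M[R]_4 :=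
  \matrix_(i < 4) nth 0 [:: x; y; z; w] i.

(* T, N, B1, B2 is the Cartan frame of alpha and k2, k3 are its Cartan
   curvatures, s being the pseudo-arc length parameter. *)
Record null_cartan_curve (R : realType) (I : set R)
    (alpha T N B1 B2 : R -> 'rV[R]_4) (k2 k3 : R -> R) : Prop := {
  ncc_interval : nondegenerate_interval I;
  ncc_smooth : smooth_in I alpha;
  ncc_smooth_B1 : smooth_in I B1;
  ncc_smooth_B2 : smooth_in I B2;
  ncc_smooth_k2 : smooth_in I k2;
  ncc_smooth_k3 : smooth_in I k3;
  ncc_regular : forall s, I s -> deriv_in I alpha s <> 0;
  ncc_null : forall s, I s ->
    minkowski (deriv_in I alpha s) (deriv_in I alpha s) = 0;
  ncc_pseudo_arc : forall s, I s ->
    minkowski (derivn_in I 2 alpha s) (derivn_in I 2 alpha s) = 1;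
  ncc_T : forall s, I s -> T s = deriv_in I alpha s;
  ncc_N : forall s, I s -> N s = derivn_in I 2 alpha s;
  ncc_TT : forall s, I s -> minkowski (T s) (T s) = 0;
  ncc_B2B2 : forall s, I s -> minkowski (B2 s) (B2 s) = 0;
  ncc_NN : forall s, I s -> minkowski (N s) (N s) = 1;
  ncc_B1B1 : forall s, I s -> minkowski (B1 s) (B1 s) = 1;
  ncc_TB2 : forall s, I s -> minkowski (T s) (B2 s) = 1;
  ncc_TN : forall s, I s -> minkowski (T s) (N s) = 0;
  ncc_TB1 : forall s, I s -> minkowski (T s) (B1 s) = 0;
  ncc_NB1 : forall s, I s -> minkowski (N s) (B1 s) = 0;
  ncc_NB2 : forall s, I s -> minkowski (N s) (B2 s) = 0;
  ncc_B1B2 : forall s, I s -> minkowski (B1 s) (B2 s) = 0;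
  ncc_det : forall s, I s -> \det (mx_of_rows4 (T s) (N s) (B1 s) (B2 s)) = 1;
  ncc_T' : forall s, I s -> deriv_in I T s = N s;
  ncc_N' : forall s, I s -> deriv_in I N s = k2 s *: B1 s - B2 s;
  ncc_B1' : forall s, I s -> deriv_in I B1 s = k3 s *: T s - k2 s *: N s;
  ncc_B2' : forall s, I s -> deriv_in I B2 s = - k3 s *: B1 s
}.

Definition null_cartan_helix (R : realType) (I : set R)
    (alpha T N B1 B2 : R -> 'rV[R]_4) (k2 k3 : R -> R) (p q : R) : Prop :=
  [/\ null_cartan_curve I alpha T N B1 B2 k2 k3,
      forall s, I s -> k2 s = p,
      forall s, I s -> k3 s = q
    & q <> 0].

(* Main.v *)
Require Import Defs.
From mathcomp Require Import all_boot all_order all_algebra.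
From mathcomp Require Import all_classical all_reals all_analysis.
Import Order.TTheory GRing.Theory Num.Theory.
Import numFieldNormedType.Exports.
Local Open Scope ring_scope.

(** The statement is linear algebra over the Cartan equations with constant
    coefficients.  On [I],
      T'' = N' = p B1 - B2,
      T''' = p B1' - B2' = p B1' + q B1,
      B1'' = q T' - p N' = q N - p T'',
    and therefore
      T'''' = p B1'' + q B1' = (p q N - p^2 T'') + (q^2 T - p q N)
            = q^2 T - p^2 T''.
    The third derivative is kept in the form [p B1' + q B1], so that each
    differentiation acts on a combination of two fields only.

    What remains is that the derivative relative to [I] behaves like a
    derivative: it is determined by the values on [I] ([deriv_in_eq]), so that
    the Cartan equations, which hold on [I] only, can be differentiated; and it
    is linear ([deriv_in_lin]).  Linearity needs limits to be unique, that is,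
    the filter of admissible increments to be proper, which holds because a
    nondegenerate interval has no isolated point
    ([increments_in_proper]). *)

Section DerivIn.
Context {R : realType} {I : set R}.

(** The segment joining [s] to another point of [I] lies in [I], so arbitrarily
    small nonzero increments, at least on one side, are admissible. *)
Lemma increments_in_proper {s : R} :
  nondegenerate_interval I -> I s -> ProperFilter (increments_in I s).
Proof.
move=> [itvI [a [b [Ia Ib ltab]]]] Is.
have [c Ic cs] : exists2 c, I c & c != s.
  by have [<-|as_] := eqVneq a s; [exists b => //; rewrite gt_eqF | exists a].
apply: Build_ProperFilter.
rewrite /increments_in /within /= => /nbhs_ballP[e /= e0 He].
have d0 : 0 < `|c - s| by rewrite normr_gt0 subr_eq0.
(* The increment t (c - s) reaches a point between s and c when t <= 1, and is
   shorter than e because t |c - s| <= e / 2. *)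
pose t := Num.min 1 (e / 2 / `|c - s|).
have t0 : 0 < t by rewrite lt_min ltr01 !divr_gt0.
have t1 : t <= 1 by rewrite ge_min lexx.
have te : t * `|c - s| < e.
  apply: (@le_lt_trans _ _ (e / 2)); last by rewrite ltr_pdivrMr// ltr_pMr ?ltr1n.
  by rewrite -ler_pdivlMr// ge_min lexx orbT.
apply: (He (t * (c - s))) => /=.
- by rewrite -ball_normE /= sub0r normrN normrM (gtr0_norm t0).
- by rewrite mulf_neq0 ?subr_eq0// gt_eqF.
- have [sc|sc] := leP s c.
  + apply: (itvI s c) => //; rewrite lerDr mulr_ge0 ?subr_ge0 ?(ltW t0)//=.
    by rewrite -lerBrDr ler_piMl ?subr_ge0.
  + apply: (itvI c s) => //; rewrite gerDr pmulr_rle0// subr_le0 (ltW sc) andbT.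
    by rewrite -lerBlDr ler_niMl ?subr_le0// ltW.
Qed.

Context {V : normedModType R}.
Implicit Types f g : R -> V.

(** Stated as an equality of filters, so that it transports both the existence
    and the value of the limit. *)
Lemma diff_quotient_eq {f g} {s : R} :
  (forall t, I t -> f t = g t) -> I s ->
  (diff_quotient f s @ increments_in I s =
   diff_quotient g s @ increments_in I s)%classic.
Proof.
move=> fg Is; have E h : I (h + s) -> diff_quotient f s h = diff_quotient g s h.
  by move=> Ih; rewrite /diff_quotient !fg.
apply/seteqP; split=> P; rewrite /increments_in; apply: (@filterS _ 0^')%classic;
  by move=> h Ph Ih; move: (Ph Ih) => /=; rewrite E.
Qed.

Lemma deriv_in_eq {f g} {s : R} :
  (forall t, I t -> f t = g t) -> I s -> deriv_in I f s = deriv_in I g s.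
Proof. by move=> fg Is; rewrite /deriv_in (diff_quotient_eq fg Is). Qed.

Lemma derivable_in_eq {f g} {s : R} :
  (forall t, I t -> f t = g t) -> I s ->
  derivable_in I g s -> derivable_in I f s.
Proof. by move=> fg Is; rewrite /derivable_in (diff_quotient_eq fg Is). Qed.

Lemma deriv_in_lin (a b : R) f g (s : R) :
  nondegenerate_interval I -> I s ->
  derivable_in I f s -> derivable_in I g s ->
  deriv_in I (fun t => a *: f t + b *: g t) s =
  a *: deriv_in I f s + b *: deriv_in I g s.
Proof.
move=> ndI Is df dg; have PF := increments_in_proper ndI Is.
apply: cvg_lim; first exact: norm_hausdorff.
have -> : diff_quotient (fun t => a *: f t + b *: g t) s =
    (fun h => a *: diff_quotient f s h + b *: diff_quotient g s h).
  apply/funext => h; rewrite /diff_quotient opprD addrACA -!scalerBr scalerDr.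
  by rewrite !scalerA ![h^-1 * _]mulrC.
by apply: cvgD; apply: cvgZl_tmp.
Qed.

End DerivIn.

Theorem theorem9 (R : realType) (I : set R)
  (alpha T N B1 B2 : R -> 'rV[R]_4) (k2 k3 : R -> R) (p q : R)
  (Halpha : null_cartan_helix I alpha T N B1 B2 k2 k3 p q) :
  forall s : R, I s ->
    derivn_in I 4 T s + p ^+ 2 *: derivn_in I 2 T s - q ^+ 2 *: T s = 0.
Proof.
case: Halpha => C k2p k3q _ s Is.
have ndI := ncc_interval C.
have salpha : smooth_in I alpha := ncc_smooth C.
have sB1 : smooth_in I B1 := ncc_smooth_B1 C.
have sB2 : smooth_in I B2 := ncc_smooth_B2 C.
(* The smoothness of T and N comes from alpha, whose first and second derivatives
   they are on I. *)
have dT t : I t -> derivable_in I T t.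
  by move=> It; exact: derivable_in_eq (ncc_T C) It (salpha 1%N t It).
have dN t : I t -> derivable_in I N t.
  by move=> It; exact: derivable_in_eq (ncc_N C) It (salpha 2%N t It).
have dB1 t : I t -> derivable_in I B1 t := sB1 0%N t.
have dB1' t : I t -> derivable_in I (deriv_in I B1) t := sB1 1%N t.
have dB2 t : I t -> derivable_in I B2 t := sB2 0%N t.
have B1E t : I t -> deriv_in I B1 t = q *: T t + (- p) *: N t.
  by move=> It; rewrite (ncc_B1' C)// k2p// k3q// scaleNr.
have T2N t : I t -> derivn_in I 2 T t = deriv_in I N t.
  by move=> It; exact: deriv_in_eq (ncc_T' C) It.
have T2 t : I t -> derivn_in I 2 T t = p *: B1 t + (-1) *: B2 t.
  by move=> It; rewrite T2N// (ncc_N' C)// k2p// scaleN1r.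
have T3 t : I t -> derivn_in I 3 T t = p *: deriv_in I B1 t + q *: B1 t.
  move=> It; rewrite [LHS](deriv_in_eq T2 It) deriv_in_lin//;
    try by auto.
  by rewrite (ncc_B2' C)// k3q// scaleN1r scaleNr opprK.
have B1'' : deriv_in I (deriv_in I B1) s = q *: N s + (- p) *: derivn_in I 2 T s.
  rewrite (deriv_in_eq B1E Is) deriv_in_lin//; try by auto.
  by rewrite (ncc_T' C)// T2N.
have -> : derivn_in I 4 T s =
    p *: deriv_in I (deriv_in I B1) s + q *: deriv_in I B1 s.
  by rewrite [LHS](deriv_in_eq T3 Is) deriv_in_lin//; auto.
rewrite B1'' B1E// !scalerDr !scalerA !mulrN !scaleNr -!expr2 (mulrC q p).
by rewrite [X in X + _ - _]addrC subrKA subrK subrr.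
Qed.
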